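(* Fix integers $n\geq 3$, $f\geq 0$, $d\geq 3$ and $k\geq 2$. Then there exists a finite simple non-complete connected graph $G$ on the vertex set $[n]=\{1,\ldots,n\}$ with $f(G)=f$, $\operatorname{diam}(G)=d$ and $\kappa(G)=k$ if and only if \[ n\geq k(d-1)+\max\{2,f\}. \]
   Context: For a finite simple connected graph $G$ on $[n]$: the distance of two distinct vertices is the smallest length (number of edges) of a path in $G$ connecting them, and $\operatorname{diam}(G)$ is the maximum of all such distances. $\kappa(G)$ denotes the vertex connectivity: for non-complete $G$, the smallest cardinality of a subset $T\subset[n]$ such that the induced subgraph of $G$ on $[n]\setminus T$ is disconnected. A vertex $i$ is free (simplicial) if whenever $\{i,j\},\{i,j'\}\in E(G)$ with $j\neq j'$, then $\{j,j'\}\in E(G)$. $f(G)$ denotes the number of free vertices of $G$. *)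

(* Defs.v *)
From mathcomp Require Import all_boot.

Set Implicit Arguments.
Unset Strict Implicit.
Unset Printing Implicit Defensive.

(* A finite simple graph is given by its vertex type V and its adjacency
   relation e : rel V. *)

Definition simple_graph (V : finType) (e : rel V) : Prop :=
  symmetric e /\ irreflexive e.

Definition complete_graph (V : finType) (e : rel V) : bool :=
  [forall x, forall y, (x != y) ==> e x y].

Definition induced (V : finType) (e : rel V) (A : {set V}) : rel V :=
  [rel x y | [&& x \in A, y \in A & e x y]].

(* The empty induced subgraph counts as connected. *)
Definition connected_on (V : finType) (e : rel V) (A : {set V}) : bool :=
  [forall x in A, forall y in A, connect (induced e A) x y].

Definition connected_graph (V : finType) (e : rel V) : bool :=
  connected_on e [set: V].

Definition simple_path (V : finType) (e : rel V) (x y : V) (p : seq V) : bool :=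
  [&& path e x p, last x p == y & uniq (x :: p)].

(* The number of edges of the path x :: p is size p.  Since vertices do not
   repeat, it is less than #|V|; the value is #|V| when no path exists
   (see gdistP). *)
Definition gdist (V : finType) (e : rel V) (x y : V) : nat :=
  find (fun m => [exists p : m.-tuple V, simple_path e x y p]) (iota 0 #|V|).

Definition diam (V : finType) (e : rel V) : nat :=
  \max_(x : V) \max_(y : V | x != y) gdist e x y.

(* The default #|V| is reached only if no induced subgraph is disconnected,
   that is, only if the graph is complete (see connectivityP). *)
Definition connectivity (V : finType) (e : rel V) : nat :=
  \big[minn/#|V|]_(T : {set V} | ~~ connected_on e (~: T)) #|T|.

Definition free_vertex (V : finType) (e : rel V) (i : V) : bool :=
  [forall j, forall j', [&& e i j, e i j' & j != j'] ==> e j j'].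

Definition num_free (V : finType) (e : rel V) : nat :=
  #|[set i | free_vertex e i]|.

Lemma gdistP (V : finType) (e : rel V) (x y : V) : connect e x y ->
  (exists2 p, simple_path e x y p & size p = gdist e x y) /\
  (forall p, simple_path e x y p -> gdist e x y <= size p).
Proof.
move=> /connectP[p0 e0 y0].
pose a m := [exists p : m.-tuple V, simple_path e x y p].
have ltV p : simple_path e x y p -> size p < #|V|.
  by case/and3P=> _ _ /card_uniqP /= <-; apply: max_card.
have aS p : simple_path e x y p -> a (size p).
  by move=> sp; apply/existsP; exists (in_tuple p).
have [q sq] : exists q, simple_path e x y q.
  case/shortenP: e0 y0 => q eq uq _ ->.
  by exists q; rewrite /simple_path eq eqxx uq.
have hq : has a (iota 0 #|V|).
  by apply/hasP; exists (size q); [rewrite mem_iota ltV | apply: aS].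
split=> [|p sp].
  have := nth_find 0 hq; rewrite nth_iota; last by rewrite has_find size_iota in hq.
  by case/existsP=> p sp; exists p => //; rewrite size_tuple.
rewrite leqNgt; apply/negP=> lt.
have := before_find 0 lt; rewrite nth_iota ?ltV // add0n => /negbT/negP[].
exact: aS.
Qed.

Lemma connectivityP (V : finType) (e : rel V) :
  simple_graph e -> ~~ complete_graph e ->
  (exists2 T : {set V}, ~~ connected_on e (~: T) & #|T| = connectivity e) /\
  (forall T : {set V}, ~~ connected_on e (~: T) -> connectivity e <= #|T|).
Proof.
move=> [_ irr] nc; pose P T := ~~ connected_on e (~: T : {set V}).
have [T0 PT0] : exists T0, P T0.
  case/forallPn: nc => x /forallPn[y]; rewrite negb_imply => /andP[xy nxy].
  exists (~: [set x; y]); rewrite /P setCK; apply/negP.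
  move=> /forall_inP/(_ x (set21 x y))/forall_inP/(_ y (set22 x y)).
  case/connectP=> [[|z p]] /=; first by move=> _ yx; rewrite yx eqxx in xy.
  case/andP=> /and3P[_ /set2P[]-> exz] _ _; first by rewrite irr in exz.
  by rewrite exz in nxy.
have minE T : P T -> connectivity e <= #|T|.
  move=> PT; rewrite /connectivity; have := mem_index_enum T.
  elim: (index_enum _) => // U r IHr; rewrite inE big_cons.
  case/predU1P=> [<-|/IHr le]; first by rewrite [X in if X then _ else _]PT geq_minl.
  by case: ifP => // _; rewrite geq_min le orbT.
split=> //.
have [] : connectivity e = #|V| \/ exists2 T, P T & #|T| = connectivity e.
  rewrite /connectivity; elim/big_ind: _ => [|a b ha hb|T PT]; first by left.
    by rewrite /minn; case: ifP.
  by right; exists T.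
move=> cV; exists T0 => //; apply/eqP; rewrite eqn_leq minE // cV max_card //.
by [].
Qed.

(* Main.v *)
Require Import Defs.
From mathcomp Require Import all_boot.
From mathcomp Require Import zify.

Set Implicit Arguments.
Unset Strict Implicit.

(** Necessity: let [x], [y] be at distance [d]. Free vertices can be bypassed
    along any walk, so for [0 < i < d] the non-free vertices at distance [i]
    from [x] already separate [x] from [y]; hence there are at least [k] of
    them, and neither [x], [y] nor the free vertices are counted in these
    [k * (d - 1)] vertices.

    Sufficiency: arrange the vertices in layers [0, ..., d], the inner ones of
    size at least [k] and layer 1 of size exactly [k], and join all vertices in
    consecutive layers. With all layers cliques, exactly the vertices in the two
    outer layers are free. If [f <= 1], each outer layer is a single vertex, and
    it is made non-free by turning the adjacent layer into an independent set. *)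

(** * Walks, distances and levels *)

Lemma simple_graph_sym (V : finType) (e : rel V) :
  simple_graph e -> symmetric e.
Proof. by case. Qed.

Lemma induced_sym (V : finType) (e : rel V) (A : {set V}) :
  symmetric e -> symmetric (induced e A).
Proof. by move=> sym x y; rewrite /induced /= sym andbCA. Qed.

Lemma path_induced_sub (V : finType) (e : rel V) (A : {set V}) x p :
  path (induced e A) x p -> path e x p.
Proof. by apply: sub_path => u v /and3P[]. Qed.

Lemma path_induced_mem (V : finType) (e : rel V) (A : {set V}) x p :
  path (induced e A) x p -> {subset p <= A}.
Proof.
elim: p x => [|u p IHp] x //= /andP[/and3P[_ uA _] /IHp sub] z.
by rewrite inE => /predU1P[->|/sub].
Qed.

Lemma connected_graph_connect (V : finType) (e : rel V) x y :
  connected_graph e -> connect e x y.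
Proof.
move=> /forall_inP/(_ x (in_setT x))/forall_inP/(_ y (in_setT y)).
by apply: connect_sub => u v /and3P[_ _ /connect1].
Qed.

(** [gdistP] bounds the distance by simple paths only; a walk shortens to a simple path through some
    of its own vertices. *)
Lemma gdist_le_walk (V : finType) (e : rel V) x p :
  path e x p -> gdist e x (last x p) <= size p.
Proof.
move=> ep; have cxy : connect e x (last x p) by apply/connectP; exists p.
move: cxy; case/shortenP: ep => q eq uq sub cxy.
apply: leq_trans (uniq_leq_size _ sub); last by case/andP: uq.
by apply: (gdistP cxy).2; rewrite /simple_path eq eqxx uq.
Qed.

Lemma gdistxx (V : finType) (e : rel V) x : gdist e x x = 0.
Proof. by apply/eqP; rewrite -leqn0 (@gdist_le_walk _ e x [::]). Qed.

Lemma gdist_edge (V : finType) (e : rel V) x u v :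
  connect e x u -> e u v -> gdist e x v <= (gdist e x u).+1.
Proof.
move=> /gdistP[[p /and3P[ep /eqP lp _] <-] _] euv.
have := @gdist_le_walk _ e x (rcons p v).
by rewrite rcons_path ep lp euv last_rcons size_rcons; apply.
Qed.

Lemma path_level_le (V : finType) (e : rel V) (lev : V -> nat) x p :
  (forall u v, e u v -> lev v <= (lev u).+1) ->
  path e x p -> lev (last x p) <= lev x + size p.
Proof.
move=> lip; elim: p x => [|u p IHp] x /=; first by rewrite addn0.
by case/andP=> /lip le_u /IHp; lia.
Qed.

(** A discrete intermediate value argument: levels rise by at most one along an edge. *)
Lemma path_hits_level (V : finType) (e : rel V) (lev : V -> nat) x p i :
  (forall u v, e u v -> lev v <= (lev u).+1) ->
  path e x p -> lev x < i -> i <= lev (last x p) ->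
  exists2 z, z \in p & lev z = i.
Proof.
move=> lip; elim: p x => [|u p IHp] x /=; first by lia.
case/andP=> /lip le_u ep ltx ley.
have [ui|ui] := eqVneq (lev u) i; first by exists u; rewrite ?mem_head.
have [|z zp zi] := IHp u ep _ ley; first by lia.
by exists z; rewrite // inE zp orbT.
Qed.

(** * The lower bound on the number of vertices *)

(** Induction on the length: the two neighbours on the walk of an interior free vertex are equal or
    adjacent, so that vertex can be cut out and the walk stays in [A]. *)
Lemma connect_nonfree_path (V : finType) (e : rel V) (A : {set V}) x y :
  symmetric e -> connect (induced e A) x y ->
  exists p, [/\ path (induced e A) x p, last x p = y &
                forall z, z \in p -> z != y -> ~~ free_vertex e z].
Proof.
move=> sym /connectP[p + ->].
have [m] := ubnP (size p); elim: m p => // m IHm p lt_pm ep.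
have [/hasP[z zp /andP[zy fz]]|nfree] :=
    boolP (has [pred z | (z != last x p) && free_vertex e z] p); last first.
  exists p; split=> // z zp zy; apply: contra nfree => fz.
  by apply/hasP; exists z; rewrite //= zy.
(* As [z] differs from the endpoint, it has a successor [w] on the walk. *)
case/splitPr: zp ep lt_pm zy => p1 [|w p2]; first by rewrite last_cat eqxx.
rewrite cat_path last_cat size_cat /= => /and4P[ep1 euz ezw ep2] lt_pm _.
have [wu|wu] := eqVneq (last x p1) w.
  have := IHm (p1 ++ p2); rewrite cat_path last_cat size_cat wu ep1 ep2.
  by apply; lia.
have := IHm (p1 ++ w :: p2); rewrite cat_path last_cat size_cat /= ep1 ep2 andbT.
apply; first by lia.
case/and3P: euz => uA _ euz; case/and3P: ezw => _ wA ezw.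
rewrite /induced /= uA wA.
move/forallP/(_ (last x p1))/forallP/(_ w)/implyP: fz; apply.
by rewrite sym euz ezw.
Qed.

(** Were this set [T] not a cut, a walk from [x] to [y] outside [T] with no free interior vertex
    would still cross distance [i], at a non-free vertex, hence inside [T]. *)
Lemma connectivity_le_nonfree_layer (V : finType) (e : rel V) x y i :
  simple_graph e -> ~~ complete_graph e -> connected_graph e ->
  0 < i < gdist e x y ->
  connectivity e <= #|[set z | ~~ free_vertex e z & gdist e x z == i]|.
Proof.
move=> sg nc cg /andP[i0 iy]; apply: (connectivityP sg nc).2.
set T := [set z | _ & _]; apply/negP => /forall_inP/(_ x).
rewrite !inE gdistxx [0 == i]eq_sym -[i == 0]negbK -lt0n i0 andbF => /(_ isT).
move=> /forall_inP/(_ y); rewrite !inE (gtn_eqF iy) andbF => /(_ isT) cxy.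
have [p [ep lp nfree]] := connect_nonfree_path (simple_graph_sym sg) cxy.
have [|||z zp zi] := @path_hits_level _ e (gdist e x) x p i _
    (path_induced_sub ep).
- by move=> u v; apply: gdist_edge; apply: connected_graph_connect.
- by rewrite gdistxx.
- by rewrite lp ltnW.
have := path_induced_mem ep zp; rewrite !inE zi eqxx andbT nfree //.
by apply: contraTneq iy => <-; rewrite zi ltnn.
Qed.

Lemma card_levels_ge (V : finType) (A : {set V}) (g : V -> nat) k m :
  (forall i, 0 < i <= m -> k <= #|[set z in A | g z == i]|) ->
  k * m <= #|[set z in A | 0 < g z <= m]|.
Proof.
elim: m => [|m IHm] lek; first by rewrite muln0.
have/IHm le_m i : 0 < i <= m -> k <= #|[set z in A | g z == i]|.
  by move=> ?; apply: lek; lia.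
have -> : [set z in A | 0 < g z <= m.+1] =
    [set z in A | 0 < g z <= m] :|: [set z in A | g z == m.+1].
  by apply/setP => z; rewrite !inE -andb_orr; congr (_ && _); lia.
rewrite cardsU disjoint_setI0 ?cards0 ?subn0.
  by rewrite mulnS addnC leq_add // lek /=.
by apply/pred0P => z; rewrite /= !inE; lia.
Qed.

Lemma gdist_le_diam (V : finType) (e : rel V) x y : gdist e x y <= diam e.
Proof.
have [->|xy] := eqVneq x y; first by rewrite gdistxx.
apply: leq_trans (leq_bigmax x).
exact: (@leq_bigmax_cond _ (fun y => x != y) (gdist e x)).
Qed.

(** Positivity excludes an empty [V], where the maximum is 0 by default and no pair attains it. *)
Lemma diam_attained (V : finType) (e : rel V) :
  0 < diam e -> exists x y, gdist e x y = diam e.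
Proof.
move=> d0; have [/existsP[x /existsP[y /eqP xy]]|none] :=
    boolP [exists x, exists y, gdist e x y == diam e]; first by exists x, y.
suff : diam e <= (diam e).-1 by lia.
apply/bigmax_leqP => x _; apply/bigmax_leqP => y xy.
have le_d := gdist_le_diam e x y; move: none; rewrite negb_exists => /forallP/(_ x).
by rewrite negb_exists => /forallP/(_ y); lia.
Qed.

Lemma card_ge_diam_connectivity (V : finType) (e : rel V) :
  simple_graph e -> ~~ complete_graph e -> connected_graph e ->
  0 < diam e ->
  connectivity e * (diam e - 1) + maxn 2 (num_free e) <= #|V|.
Proof.
move=> sg nc cg d0; have [x [y dxy]] := diam_attained d0.
pose N := [set z | ~~ free_vertex e z].
have : connectivity e * (diam e - 1) <=
    #|[set z in N | 0 < gdist e x z <= diam e - 1]|.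
  apply: card_levels_ge => i ii.
  have -> : [set z in N | gdist e x z == i] =
      [set z | ~~ free_vertex e z & gdist e x z == i].
    by apply/setP => z; rewrite !inE.
  by apply: (@connectivity_le_nonfree_layer _ e x y) => //; lia.
set S := [set z in N | _] => leS.
have xy : x != y by apply: contraTneq d0 => xy; rewrite -dxy xy gdistxx.
(* [S] consists of non-free vertices, so it is disjoint from the free ones. *)
have leF : #|S| + num_free e <= #|V|.
  rewrite -(cardsC N) leq_add //; last by rewrite subset_leq_card //;
    apply/subsetP => z; rewrite !inE negbK.
  by apply/subset_leq_card/subsetP => z; rewrite inE => /andP[].
(* [x] and [y] lie at distances 0 and [diam e], both outside the range that defines [S]. *)
have le2 : #|S| + 2 <= #|V|.
  rewrite -(cardsC S) leq_add2l.
  have <- : #|[set x; y]| = 2 by rewrite cards2 xy.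
  apply/subset_leq_card/subsetP => z; rewrite !inE.
  by case/orP=> /eqP->; rewrite ?gdistxx ?dxy; lia.
by lia.
Qed.

(** * Layered graphs *)

(* [clq i] tells whether layer [i] is a clique or an independent set. *)
Definition layered (V : finType) (lev : V -> nat) (clq : pred nat) : rel V :=
  [rel x y | [&& x != y, lev x <= (lev y).+1, lev y <= (lev x).+1 &
                 (lev x == lev y) ==> clq (lev x)]].

Lemma layered_simple (V : finType) (lev : V -> nat) (clq : pred nat) :
  simple_graph (layered lev clq).
Proof.
split=> [x y|x]; last by rewrite /layered /= eqxx.
rewrite /layered /= [y == x]eq_sym [lev y == _]eq_sym.
have [->|_] := eqVneq (lev x) (lev y) => //=.
by case: (x != y); rewrite //= !andbT andbC.
Qed.

Lemma layered_succ (V : finType) (lev : V -> nat) (clq : pred nat) x y :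
  lev y = (lev x).+1 -> layered lev clq x y.
Proof.
move=> xy; rewrite /layered /= xy leqnn leqW //= ?(ltn_eqF (ltnSn _)) ?andbT //.
by apply/eqP => yx; move: xy; rewrite yx; lia.
Qed.

Lemma layered_lipschitz (V : finType) (lev : V -> nat) (clq : pred nat) x y :
  layered lev clq x y -> lev y <= (lev x).+1.
Proof. by case/and4P. Qed.

Lemma layered_up_walk (V : finType) (lev : V -> nat) (clq : pred nat)
    (A : {set V}) m x y :
  x \in A -> y \in A -> lev y = lev x + m.+1 ->
  (forall i, lev x < i < lev y -> exists2 z, z \in A & lev z = i) ->
  exists p, [/\ path (induced (layered lev clq) A) x p, last x p = y &
                size p = m.+1].
Proof.
elim: m x => [|m IHm] x xA yA xy hit.
  exists [:: y]; split=> //=.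
  by rewrite /induced /= xA yA layered_succ // xy addn1.
have [|z zA zx] := hit (lev x).+1; first by lia.
have [|i ii|p [ep lp sp]] := IHm z zA yA; first by lia.
  by apply: hit; lia.
exists (z :: p); split; rewrite //= ?ep ?sp //.
by rewrite /induced /= xA zA layered_succ.
Qed.

(** Between different levels, climb or descend one layer at a time; within one level, step to an
    adjacent inner layer and back, which works in independent layers too. The set [A] is everything
    for the diameter and the complement of a small set for the connectivity. *)
Lemma layered_walk (V : finType) (lev : V -> nat) (clq : pred nat)
    (A : {set V}) d x y :
  2 < d -> (forall z, lev z <= d) ->
  (forall i, 0 < i < d -> exists2 z, z \in A & lev z = i) ->
  x \in A -> y \in A ->
  exists p, [/\ path (induced (layered lev clq) A) x p, last x p = y &
                size p <= d].
Proof.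
move=> d3 led hit xA yA.
have sym := simple_graph_sym (layered_simple lev clq).
have [lt|lt|eq] := ltngtP (lev x) (lev y).
- have [|i ii|p [ep lp sp]] :=
    @layered_up_walk _ lev clq A (lev y - lev x).-1 x y xA yA; first by lia.
    by apply: hit; have := led y; lia.
  by exists p; split=> //; have := led y; lia.
- have [|i ii|p [ep lp sp]] :=
    @layered_up_walk _ lev clq A (lev x - lev y).-1 y x yA xA; first by lia.
    by apply: hit; have := led x; lia.
  exists (rev (belast y p)); rewrite -lp size_rev size_belast; split.
  + by rewrite rev_path; apply: sub_path ep => u v; rewrite induced_sym.
  + by case: p {ep lp} sp => [|z p] //=; rewrite rev_cons last_rcons.
  + by have := led x; lia.
have [z zA zx] : exists2 z, z \in A & lev z = (lev x).+1 \/ lev x = (lev z).+1.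
  (* Since [2 < d], the level above is inner when [lev x < d.-1], and the level below is inner
     otherwise. *)
  have := led x; have [lt|ge] := ltnP (lev x) d.-1 => lex.
    by have [|z zA zi] := hit (lev x).+1; [lia | exists z => //; left].
  by have [|z zA zi] := hit (lev x).-1; [lia | exists z => //; right; lia].
exists [:: z; y]; split=> //=; last by lia.
have [xz zy] : layered lev clq x z /\ layered lev clq z y.
  by case: zx => zx; split; try (apply: layered_succ; lia);
    rewrite sym; apply: layered_succ; lia.
by rewrite /induced /= xA zA yA xz zy.
Qed.

Lemma layered_connected (V : finType) (lev : V -> nat) (clq : pred nat)
    (A : {set V}) d :
  2 < d -> (forall z, lev z <= d) ->
  (forall i, 0 < i < d -> exists2 z, z \in A & lev z = i) ->
  connected_on (layered lev clq) A.
Proof.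
move=> d3 led hit; apply/forall_inP => x xA; apply/forall_inP => y yA.
have [p [ep lp _]] := @layered_walk _ lev clq A d x y d3 led hit xA yA.
by apply/connectP; exists p.
Qed.

(** Walks climb at most one level per edge, so going from layer 0 to layer [d] takes at least [d]
    edges. *)
Lemma layered_diam (V : finType) (lev : V -> nat) (clq : pred nat) d :
  2 < d -> (forall z, lev z <= d) -> (forall i, i <= d -> exists z, lev z = i) ->
  diam (layered lev clq) = d.
Proof.
move=> d3 led hit; set e := layered _ _.
have hitT i : 0 < i < d -> exists2 z, z \in [set: V] & lev z = i.
  by case/andP=> _ /ltnW/hit[z]; exists z; rewrite ?inE.
apply/eqP; rewrite eqn_leq; apply/andP; split.
  apply/bigmax_leqP => x _; apply/bigmax_leqP => y _.
  have [p [ep <- sp]] := @layered_walk _ lev clq setT d x y d3 led hitT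
    (in_setT x) (in_setT y).
  exact: leq_trans (gdist_le_walk (path_induced_sub ep)) sp.
have [x x0] := hit 0 isT; have [y yd] := hit d (leqnn d).
have cxy : connect e x y.
  apply: connected_graph_connect; exact: layered_connected d3 led hitT.
apply: leq_trans (gdist_le_diam e x y).
have [[p /and3P[ep /eqP lp _] <-] _] := gdistP cxy.
have := path_level_le (@layered_lipschitz _ lev clq) ep.
by rewrite lp x0 yd.
Qed.

Lemma layered_not_complete (V : finType) (lev : V -> nat) (clq : pred nat) x y :
  (lev x).+1 < lev y -> ~~ complete_graph (layered lev clq).
Proof.
move=> lt; apply/negP => /forallP/(_ x)/forallP/(_ y)/implyP.
have xy : x != y by apply/eqP => xy; rewrite xy in lt; lia.
by move=> /(_ xy)/layered_lipschitz; lia.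
Qed.

(** Layer 1 separates layer 0 from layer [d]. Conversely, fewer than [k] vertices cannot exhaust an
    inner layer, and a set meeting every inner layer is connected. *)
Lemma layered_connectivity (V : finType) (lev : V -> nat) (clq : pred nat) d k :
  2 < d -> (forall z, lev z <= d) -> (forall i, i <= d -> exists z, lev z = i) ->
  (forall i, 0 < i < d -> k <= #|[set z | lev z == i]|) ->
  #|[set z | lev z == 1]| = k ->
  connectivity (layered lev clq) = k.
Proof.
move=> d3 led hit lek eqk; set e := layered _ _.
have [x x0] := hit 0 isT; have [y yd] := hit d (leqnn d).
have nc : ~~ complete_graph e.
  by apply: (@layered_not_complete _ _ _ x y); lia.
have [[T cT Tk] minT] := connectivityP (layered_simple lev clq) nc.
apply/eqP; rewrite eqn_leq; apply/andP; split.
  rewrite -eqk; apply: minT; apply/negP => /forall_inP/(_ x).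
  rewrite !inE x0 => /(_ isT)/forall_inP/(_ y).
  rewrite !inE yd gtn_eqF ?(ltnW d3) // => /(_ isT)/connectP[p ep lp].
  have [||z zp z1] := @path_hits_level _ e lev x p 1
    (@layered_lipschitz _ lev clq) (path_induced_sub ep).
  - by rewrite x0.
  - by rewrite -lp yd; lia.
  by have := path_induced_mem ep zp; rewrite !inE z1.
rewrite -Tk leqNgt; apply: contra cT => ltk.
apply: (@layered_connected _ _ _ _ d) => // i ii.
have /subsetPn[z] : ~~ ([set z | lev z == i] \subset T).
  apply: contraL ltk => /subset_leq_card; rewrite -leqNgt.
  exact: leq_trans (lek i ii).
by rewrite inE => /eqP zi zT; exists z; rewrite ?inE.
Qed.

(** An inner vertex has neighbours two levels apart, which are not adjacent. An outer vertex sees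
    only its own clique and the adjacent layer, so everything depends on whether that layer, which
    has at least two vertices, is a clique. *)
Lemma layered_free (V : finType) (lev : V -> nat) (clq : pred nat) d x :
  2 < d -> (forall z, lev z <= d) -> (forall i, i <= d -> exists z, lev z = i) ->
  (forall i, 0 < i < d -> 1 < #|[set z | lev z == i]|) ->
  clq 0 -> clq d ->
  free_vertex (layered lev clq) x =
  (lev x == 0) && clq 1 || (lev x == d) && clq d.-1.
Proof.
move=> d3 led hit gt1 clq0 clqd; set e := layered _ _.
have sym : symmetric e := simple_graph_sym (layered_simple lev clq).
have nfree i : 0 < i < d -> (forall z, lev z = i -> e x z) -> ~~ clq i ->
    free_vertex e x = false.
  move=> ii xi nci; have /card_gt1P[u [v []]] := gt1 i ii.
  rewrite !inE => /eqP ui /eqP vi uv; apply/negP => /forallP/(_ u)/forallP/(_ v).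
  rewrite !xi // uv /= /e /layered /= ui vi eqxx /= => /and4P[_ _ _].
  exact/negP.
have freex j : (forall z, e x z -> (lev z == lev x) || (lev z == j)) ->
    clq (lev x) -> clq j -> (lev x <= j.+1) -> j <= (lev x).+1 ->
    free_vertex e x.
  move=> nbr cx cj xj jx; apply/forallP => u; apply/forallP => v.
  apply/implyP => /and3P[/nbr xu /nbr xv uv]; rewrite /e /layered /= uv /=.
  case/orP: xu => /eqP->; case/orP: xv => /eqP->; rewrite ?leqnSn ?xj ?jx ?cx ?cj;
    by rewrite ?implybT.
have [x0|x0] := eqVneq (lev x) 0.
  have -> : (lev x == d) = false by lia.
  rewrite /= orbF; case c1: (clq 1).
    apply: (@freex 1); rewrite ?x0 // => z /layered_lipschitz; lia.
  apply: (@nfree 1); rewrite ?c1 //; first by lia.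
  by move=> z z1; apply: layered_succ; rewrite x0.
have [xd|xd] := eqVneq (lev x) d.
  rewrite /=; case c1: (clq d.-1).
    apply: (@freex d.-1); rewrite ?xd //; try lia.
    move=> z; rewrite sym => /layered_lipschitz; have := led z; lia.
  apply: (@nfree d.-1); rewrite ?c1 //; first by lia.
  by move=> z z1; rewrite sym; apply: layered_succ; lia.
have := led x => lex; have [|u ui] := hit (lev x).-1; first by lia.
have [|v vi] := hit (lev x).+1; first by lia.
have xu : e x u by rewrite sym; apply: layered_succ; lia.
have xv : e x v by apply: layered_succ.
have uv : u != v by apply/eqP => uv; rewrite uv in ui; lia.
apply/negP => /forallP/(_ u)/forallP/(_ v)/implyP.
by rewrite xu xv uv => /(_ isT)/layered_lipschitz; lia.
Qed.

(** * Sizes of the layers *)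

Lemma card_ord_interval n a b :
  b <= n -> #|[set i : 'I_n | a <= i < b]| = b - a.
Proof.
move=> bn; rewrite -sum1dep_card -(big_mkord (fun i => a <= i < b) (fun=> 1)).
rewrite -(@big_nat_widen _ _ _ 0 b n (fun i => a <= i)) //.
by rewrite -(@big_nat_widenl _ _ _ a 0 b xpredT) // sum_nat_const_nat muln1.
Qed.

(* For [i < m] the quotient is the ceiling of [i / k]: vertex 0 is layer 0, then
   come blocks of [k] vertices, and layer [d.-1] absorbs the surplus below [m]. *)
Definition layer_index (k d m i : nat) : nat :=
  if i < m then minn d.-1 ((i + k.-1) %/ k) else d.

Lemma layer_index_le k d m i : layer_index k d m i <= d.
Proof. by rewrite /layer_index; case: ifP; lia. Qed.

(** The ceiling of [i / k] is [j] when [k * (j - 1) < i <= k * j]; adding [k] throughout avoids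
    truncated subtraction at [j = 0]. *)
Lemma divn_ceil_eq k i j :
  0 < k -> ((i + k.-1) %/ k == j) = (k * j < i + k <= k * j.+1).
Proof.
move=> k0; rewrite eqn_leq leq_divRL // -ltnS ltn_divLR // ![_ * k]mulnC.
by lia.
Qed.

Lemma layer_index_eq k d m i j :
  0 < k -> i < m -> j < d.-1 ->
  (layer_index k d m i == j) = (k * j < i + k <= k * j.+1).
Proof.
move=> k0 im jd; rewrite /layer_index im -divn_ceil_eq //.
by lia.
Qed.

(** Only an implication, because [j = d.-1] is allowed here and that layer also holds the
    surplus. *)
Lemma layer_index_in k d m i j :
  0 < k -> i < m -> j < d -> k * j < i + k <= k * j.+1 ->
  layer_index k d m i = j.
Proof.
by move=> k0 im jd; rewrite -divn_ceil_eq // /layer_index im => /eqP->; lia.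
Qed.

Lemma layer_index_last k d m i : 0 < d -> (layer_index k d m i == d) = (m <= i).
Proof. by move=> d0; rewrite /layer_index; case: ltnP; lia. Qed.

Lemma card_layer_ge n k d m j :
  0 < k -> m <= n -> k * d.-1 < m -> 0 < j < d ->
  k <= #|[set i : 'I_n | layer_index k d m i == j]|.
Proof.
move=> k0 mn lem /andP[j0 jd].
have lej : k * j <= k * d.-1 by rewrite leq_mul2l; lia.
have jj : k * j = k * j.-1 + k by rewrite -{1}(prednK j0) mulnS addnC.
(* The [j]-th block of [k] consecutive vertices lies in layer [j], and it ends before [m]. *)
apply: (@leq_trans #|[set i : 'I_n | (k * j.-1).+1 <= i < (k * j).+1]|).
  by rewrite card_ord_interval; lia.
apply/subset_leq_card/subsetP => i; rewrite !inE => ij.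
by apply/eqP; apply: layer_index_in; rewrite ?mulnS; lia.
Qed.

Lemma card_layer0 n k d m :
  0 < k -> 1 < d -> 0 < m <= n ->
  #|[set i : 'I_n | layer_index k d m i == 0]| = 1.
Proof.
move=> k0 d1 mn; rewrite -[RHS](@card_ord_interval n 0 1); last by lia.
apply: eq_card => i; rewrite !inE.
have [im|im] := ltnP i m; first by rewrite layer_index_eq //; lia.
by rewrite /layer_index ltnNge im /=; lia.
Qed.

(** As [2 < d], layer 1 is not the surplus layer [d.-1], so it is exactly the block of vertices from
    1 to [k]. *)
Lemma card_layer1 n k d m :
  0 < k -> 2 < d -> k < m <= n ->
  #|[set i : 'I_n | layer_index k d m i == 1]| = k.
Proof.
move=> k0 d2 mn; rewrite -[RHS](subn1 k.+1) -(@card_ord_interval n 1 k.+1);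
  last by lia.
apply: eq_card => i; rewrite !inE.
have [im|im] := ltnP i m; first by rewrite layer_index_eq //; lia.
by rewrite /layer_index ltnNge im /=; lia.
Qed.

Lemma card_layer_last n k d m :
  0 < d -> #|[set i : 'I_n | layer_index k d m i == d]| = n - m.
Proof.
move=> d0; rewrite -(@card_ord_interval n m n) //.
by apply: eq_card => i; rewrite !inE layer_index_last // ltn_ord andbT.
Qed.

(** * Existence of the graph, and the equivalence *)

Lemma exists_graph (n f d k : nat) :
  3 <= d -> 2 <= k -> k * (d - 1) + maxn 2 f <= n ->
  exists e : rel 'I_n,
    [/\ simple_graph e, ~~ complete_graph e & connected_graph e] /\
    [/\ num_free e = f, diam e = d & connectivity e = k].
Proof.
move=> d3 k2; rewrite subn1 => len.
(* The vertices from [m] on form layer [d]; with the single vertex of layer 0, the outer layers have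
   [maxn 2 f] vertices. *)
pose m := n - (maxn 2 f).-1; pose lev (i : 'I_n) := layer_index k d m i.
(* Layer 1 is independent only for [f = 0], and layer [d.-1] only for [f <= 1]; these two layers
   differ because [3 <= d]. *)
pose clq := [pred i | (i != 1) || (0 < f) & (i != d.-1) || (1 < f)].
have lekd : k * 2 <= k * d.-1 by rewrite leq_mul2l; lia.
have led z : lev z <= d by apply: layer_index_le.
have lek i : 0 < i < d -> k <= #|[set z | lev z == i]|.
  by apply: card_layer_ge; lia.
have card0 : #|[set z | lev z == 0]| = 1 by apply: card_layer0; lia.
have card1 : #|[set z | lev z == 1]| = k by apply: card_layer1; lia.
have cardd : #|[set z | lev z == d]| = (maxn 2 f).-1.
  by rewrite card_layer_last; lia.
have hit i : i <= d -> exists z, lev z = i.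
  move=> id; have : 0 < #|[set z | lev z == i]|.
    have [->|i0] := eqVneq i 0; first by rewrite card0.
    have [->|nid] := eqVneq i d; first by rewrite cardd; lia.
    by have := lek i; lia.
  by case/card_gt0P => z; rewrite inE => /eqP; exists z.
have [x x0] := hit 0 isT; have [y yd] := hit d (leqnn d).
exists (layered lev clq); split; split.
- exact: layered_simple.
- by apply: (@layered_not_complete _ _ _ x y); lia.
- apply: (@layered_connected _ _ _ _ d) => // i /andP[_ /ltnW/hit[z]].
  by exists z; rewrite ?inE.
- have freeE z : free_vertex (layered lev clq) z =
      (lev z == 0) && (0 < f) || (lev z == d) && (1 < f).
    rewrite (@layered_free _ _ _ d) //=; try lia.
    by move=> i /lek; apply: leq_trans.
  (* For [f >= 2] the free vertices are the [1 + (f - 1)] outer ones; for [f = 1] only layer 0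
     remains free, and for [f = 0] none. *)
  rewrite /num_free; have [f2|f2] := ltnP 1 f.
    have -> : [set z | free_vertex (layered lev clq) z] =
        [set z | lev z == 0] :|: [set z | lev z == d].
      by apply/setP => z; rewrite !inE freeE f2 (ltnW f2) !andbT.
    rewrite cardsU disjoint_setI0 ?cards0 ?card0 ?cardd; first by lia.
    by apply/pred0P => z; rewrite /= !inE; lia.
  have [f0|f0] := posnP f.
    by rewrite [RHS]f0; apply: eq_card0 => z; rewrite inE freeE f0 !andbF.
  have f1 : f = 1 by lia.
  rewrite [RHS]f1 -[RHS]card0; apply: eq_card => z.
  by rewrite !inE freeE f1 andbT andbF orbF.
- exact: layered_diam.
- exact: (@layered_connectivity _ _ _ d).
Qed.

Unset Implicit Arguments.
Set Strict Implicit.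

Theorem theorem3p3 (n f d k : nat)
    (hn : 3 <= n) (hf : 0 <= f) (hd : 3 <= d) (hk : 2 <= k) :
  (exists e : rel 'I_n,
     [/\ simple_graph e, ~~ complete_graph e & connected_graph e] /\
     [/\ num_free e = f, diam e = d & connectivity e = k])
  <-> k * (d - 1) + maxn 2 f <= n.
Proof.
split=> [[e [[sg nc cg] [<- de <-]]]|]; last exact: exists_graph.
rewrite -de -[leqRHS]card_ord; apply: card_ge_diam_connectivity => //.
by rewrite de; apply: leq_trans hd.
Qed.
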